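(* Let $R$ be a commutative unitary ring with multiplicative semigroup $\mathcal{S}_R$, and let $a\in\mathcal{S}_R^{\bullet}$ (i.e. $a\in R$, $a\neq 1_R$) be an element with $\Psi(a)$ finite. Let $R_a=R/\mathrm{Ann}(a)$ be the quotient ring of $R$ modulo the annihilator of $a$, and let $\mathrm{U}(R_a)$ be its group of units. Then $$\Gamma(H_a)\cong \mathrm{U}(R_a).$$ If $\mathrm{U}(R_a)$ is infinite, then $\mathrm{D}_a(\mathcal{S}_R)$ is infinite. If $\mathrm{U}(R_a)$ is finite, then $\mathrm{D}_a(\mathcal{S}_R)$ is finite and $$\epsilon\,\mathrm{D}(\mathrm{U}(R_a))\ \leq\ \mathrm{D}_a(\mathcal{S}_R)\ \leq\ \Psi(a)+\mathrm{D}(\mathrm{U}(R_a))-1,$$ where $\epsilon=\frac12$ if $a^2\ \mathcal{H}\ a$ (i.e. $(a^2)=(a)$), and $\epsilon=1$ otherwise. In particular, if $R$ is a finite commutative principal ideal unitary ring and $a\notin\mathrm{U}(R)$, then $$\mathrm{D}_a(\mathcal{S}_R)=\Psi(a)+\mathrm{D}(\mathrm{U}(R_a))-1.$$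
   Context: For a commutative unitary ring $R$, $\mathcal{S}_R$ denotes its multiplicative semigroup, a commutative monoid with identity $1_R$; $\mathcal{S}_R^{\bullet}=R\setminus\{1_R\}$. $\mathrm{U}(R)$ is the unit group and $\mathrm{Ann}(a)=\{c\in R: ca=0\}$. A principal ideal ring is one in which every ideal is principal. A sequence over $\mathcal{S}_R$ is a finite multiset $T$ of elements of $R$, $|T|$ is its length (with multiplicity), and its ''sum'' in the semigroup $\mathcal{S}_R$ is the product $\pi(T)$ in $R$ of its terms; the empty sequence has product $1_R$. $T$ is reducible if it has a proper (possibly empty) subsequence $T'\neq T$ with $\pi(T')=\pi(T)$, and irreducible otherwise. $\mathrm{D}_a(\mathcal{S}_R)\in\mathbb{N}\cup\{\infty\}$ is the largest length (supremum of lengths) of irreducible sequences $T$ with $\pi(T)=a$. For an abelian group $G$, $\mathrm{D}(G)$ is the Davenport constant: the smallest $\ell\in\mathbb{N}\cup\{\infty\}$, with $\mathbb{N}=\{1,2,\dots\}$, such that every sequence over $G$ of length at least $\ell$ has a nonempty subsequence whose terms combine to the identity of $G$ (equivalently, is reducible). $(a)=aR$ is the principal ideal generated by $a$. Green's congruence on $\mathcal{S}_R$: $a\ \mathcal{H}\ b$ iff $(a)=(b)$; $H_a$ is the $\mathcal{H}$-class of $a$. $\Psi(a)\in\mathbb{N}_0\cup\{\infty\}$ is the largest $\ell$ (supremum) for which there exist $a_1,\dots,a_\ell\in R$ with $(a)\subsetneq(a_1)\subsetneq\cdots\subsetneq(a_\ell)$. Schützenberger group: let $\mathrm{St}(H_a)=\{c\in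 R: cx\in H_a\text{ for every }x\in H_a\}$. Each $c\in\mathrm{St}(H_a)$ induces a map $\gamma_c:H_a\to H_a$, $x\mapsto cx$. Then $\Gamma(H_a)=\{\gamma_c:c\in\mathrm{St}(H_a)\}$, with operation composition (the composite of $\gamma_c$ and $\gamma_d$ is $\gamma_{cd}$), is an abelian group. *)

(* Defs.v *)
From HB Require Import structures.
From mathcomp Require Import all_boot all_order all_algebra.
From mathcomp Require Import finmap multiset.
From mathcomp Require Import boolp classical_sets functions cardinality.
From mathcomp Require Import constructive_ereal.

Set Implicit Arguments.
Unset Strict Implicit.
Unset Printing Implicit Defensive.

Import Order.TTheory GRing.Theory Num.Theory.

Local Open Scope mset_scope.
Local Open Scope classical_set_scope.
Local Open Scope ring_scope.
Local Open Scope quotient_scope.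

(* Suprema and infima of sets of natural numbers, in \bar rat rather than in
   N u {oo} because they get multiplied by 1/2. The default value is only
   taken for the empty set, so that nat_inf set0 = +oo. *)
Definition nat_sup (P : set nat) : \bar rat :=
  supremum -oo%E [set n%:R%:E | n in P].

Definition nat_inf (P : set nat) : \bar rat :=
  infimum +oo%E [set n%:R%:E | n in P].

(* Abelian groups, written multiplicatively and possibly infinite. *)
HB.mixin Record Group_isCommutative G of Group G := {
  mulgC_subproof : commutative (fun x y : G => (x * y)%g)
}.

#[short(type="comGroupType")]
HB.structure Definition ComGroup := {G of Group G & Group_isCommutative G}.

Definition davenport (G : comGroupType) : \bar rat :=
  nat_inf [set l | (0 < l)%N /\
    forall T : {mset G}, (l <= size T)%N ->
      exists T' : {mset G},
        [/\ (T' `<=` T)%mset, T' != mset0 & (\prod_(x <- T') x)%g = 1%g]].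

Definition is_unit (R : comPzRingType) (x : R) : Prop :=
  exists y : R, x * y = 1.

Section UnitGroup.
Context {R : comPzRingType}.

Definition units_of : Type := {x : R | `[< is_unit x >]}.

HB.instance Definition _ := SubChoice.on units_of.

Definition units_one : units_of.
Proof. by exists 1; apply/asboolP; exists 1; rewrite mulr1. Defined.

Definition units_mul (u v : units_of) : units_of.
Proof.
exists (val u * val v); case: u v => [u pu] [v pv] /=.
move/asboolP: pu => [u' uu']; move/asboolP: pv => [v' vv'].
by apply/asboolP; exists (u' * v'); rewrite mulrACA uu' vv' mulr1.
Defined.

Lemma units_has_inv (u : units_of) : exists v, units_mul v u = units_one.
Proof.
case: u => [u pu]; have /asboolP[v uv] := pu.
have pv : `[< is_unit v >] by apply/asboolP; exists u; rewrite mulrC.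
by exists (exist _ v pv); apply: val_inj; rewrite /= mulrC.
Qed.

Definition units_inv (u : units_of) : units_of := sval (cid (units_has_inv u)).

Lemma units_mulA : associative units_mul.
Proof. by move=> u v w; apply: val_inj; rewrite /= mulrA. Qed.

Lemma units_mulC : commutative units_mul.
Proof. by move=> u v; apply: val_inj; rewrite /= mulrC. Qed.

Lemma units_mul1 : left_id units_one units_mul.
Proof. by move=> u; apply: val_inj; rewrite /= mul1r. Qed.

Lemma units_mulr1 : right_id units_one units_mul.
Proof. by move=> u; rewrite units_mulC units_mul1. Qed.

Lemma units_mulV : left_inverse units_one units_inv units_mul.
Proof. by move=> u; rewrite /units_inv; case: cid. Qed.

Lemma units_mulrV : right_inverse units_one units_inv units_mul.
Proof. by move=> u; rewrite units_mulC units_mulV. Qed.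

HB.instance Definition _ := isGroup.Build units_of
  units_mulA units_mul1 units_mulr1 units_mulV units_mulrV.
HB.instance Definition _ := Group_isCommutative.Build units_of units_mulC.

End UnitGroup.
Arguments units_of : clear implicits.

Definition annihilator (R : comPzRingType) (a : R) : {pred R} :=
  [pred c | c * a == 0].

(* The library's ring structure on {ideal_quot I} assumes 1 \notin I; here
   a = 0 is allowed, in which case R_a is the zero ring. *)
Section QuotientByAnnihilator.
Context {R : comPzRingType} (a : R).

Lemma annihilator_zmod_closed : zmod_closed (annihilator a).
Proof.
split=> [|x y]; rewrite !inE ?mul0r // => /eqP xa /eqP ya.
by rewrite mulrBl xa ya subrr.
Qed.

HB.instance Definition _ :=
  GRing.isZmodClosed.Build R (annihilator a) annihilator_zmod_closed.

Definition ann_quot : Type := Quotient.quot (annihilator a).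

HB.instance Definition _ := GRing.Zmodule.on ann_quot.
HB.instance Definition _ := Quotient.on ann_quot.

Definition ann_quot_one : ann_quot := \pi_ann_quot 1.
Definition ann_quot_mul (x y : ann_quot) : ann_quot :=
  \pi_ann_quot (repr x * repr y).

Lemma ann_quot_piE (x y : R) :
  (\pi_ann_quot x == \pi_ann_quot y) = ((x - y) * a == 0).
Proof. exact: esym (Quotient.idealrBE (annihilator a) x y). Qed.

Lemma ann_quot_piM (x y : R) :
  ann_quot_mul (\pi x) (\pi y) = \pi_ann_quot (x * y).
Proof.
apply/eqP; rewrite ann_quot_piE.
have ex : (repr (\pi_ann_quot x) - x) * a == 0 by rewrite -ann_quot_piE; apply/eqP; rewrite reprK.
have ey : (repr (\pi_ann_quot y) - y) * a == 0 by rewrite -ann_quot_piE; apply/eqP; rewrite reprK.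
set x' := repr _ in ex *; set y' := repr _ in ey *.
have -> : x' * y' - x * y = y' * (x' - x) + x * (y' - y).
  by rewrite !mulrBr addrA (mulrC x') (mulrC y' x) subrK.
by rewrite mulrDl -!mulrA (eqP ex) (eqP ey) !mulr0 addr0.
Qed.

Lemma ann_quot_mulA : associative ann_quot_mul.
Proof.
move=> x y z; rewrite -[x]reprK -[y]reprK -[z]reprK.
rewrite (ann_quot_piM (repr y) (repr z)) (ann_quot_piM (repr x) (repr y)).
by rewrite !ann_quot_piM mulrA.
Qed.

Lemma ann_quot_mulC : commutative ann_quot_mul.
Proof. by move=> x y; rewrite /ann_quot_mul mulrC. Qed.

Lemma ann_quot_mul1 : left_id ann_quot_one ann_quot_mul.
Proof. by move=> x; rewrite -[x]reprK ann_quot_piM mul1r. Qed.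

Lemma ann_quot_piD (x y : R) :
  (\pi_ann_quot x + \pi_ann_quot y : ann_quot) = \pi_ann_quot (x + y).
Proof. by rewrite /ann_quot !piE. Qed.

Lemma ann_quot_mulDl : left_distributive ann_quot_mul +%R.
Proof.
move=> x y z; rewrite -[x]reprK -[y]reprK -[z]reprK.
by rewrite ann_quot_piD !ann_quot_piM ann_quot_piD mulrDl.
Qed.

HB.instance Definition _ := GRing.Zmodule_isComPzRing.Build ann_quot
  ann_quot_mulA ann_quot_mulC ann_quot_mul1 ann_quot_mulDl.

End QuotientByAnnihilator.

Section Semigroup.
Context {R : comPzRingType}.
Implicit Types (a x : R).

Definition reducible (T : {mset R}) : Prop :=
  exists2 T' : {mset R},
    (T' `<` T)%mset & \prod_(x <- T') x = \prod_(x <- T) x.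

(* The largest length of an irreducible sequence of product a. *)
Definition davenport_at a : \bar rat :=
  nat_sup [set size T | T in
    [set T : {mset R} | ~ reducible T /\ \prod_(x <- T) x = a]].

Definition pideal a : set R := [set a * r | r in [set: R]].

Definition greenH a b : Prop := pideal a = pideal b.

(* The largest length of a strictly ascending chain of principal ideals
   starting from, and not counting, (a). *)
Definition Psi a : \bar rat :=
  nat_sup [set l | exists2 f : nat -> R, f 0%N = a &
    forall i, (i < l)%N -> pideal (f i) `<` pideal (f i.+1)].

Definition Hclass a : set R := [set x | greenH x a].

Definition stab a : set R :=
  [set c | forall x, Hclass a x -> Hclass a (c * x)].

Lemma translation_subproof a (c : stab a) (x : Hclass a) :
  val c * val x \in Hclass a.
Proof. by apply/mem_set/(set_mem (valP c))/(set_mem (valP x)). Qed.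

Definition translation a (c : stab a) (x : Hclass a) : Hclass a :=
  Sub (val c * val x) (translation_subproof c x).

Lemma pideal_subP x y : pideal x `<=` pideal y <-> pideal y x.
Proof.
split=> [|[r _ <-] _ [s _ <-]]; first by apply; exists 1; rewrite ?mulr1.
by exists (r * s) => //; rewrite mulrA.
Qed.

Lemma greenHP x y : greenH x y <-> pideal y x /\ pideal x y.
Proof.
by rewrite /greenH eqEsubset; split=> -[/pideal_subP ? /pideal_subP ?].
Qed.

Section Schutzenberger.
Variable a : R.

(* The group of translations of the H-class of a by its stabilizer, under
   composition: translations by distinct c may coincide. *)
Definition schutz : Type := range (@translation a).

HB.instance Definition _ := SubChoice.on schutz.

Lemma schutzP (g : schutz) : exists c : stab a, val g = translation c.
Proof. by have [c _ <-] := set_mem (valP g); exists c. Qed.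

Definition schutz_of (c : stab a) : schutz :=
  Sub (translation c) (mem_set (imageP (@translation a) (I : [set: stab a] c))).

Lemma schutz_mul_subproof (g h : schutz) :
  val g \o val h \in range (@translation a).
Proof.
have [c ->] := schutzP g; have [d ->] := schutzP h; apply/mem_set.
have cd : val c * val d \in stab a.
  apply/mem_set => x Hx; rewrite -mulrA.
  by apply/(set_mem (valP c))/(set_mem (valP d)).
exists (Sub (val c * val d) cd) => //; apply/funext => x.
by apply: val_inj; rewrite /= mulrA.
Qed.

Definition schutz_mul (g h : schutz) : schutz :=
  Sub (val g \o val h) (schutz_mul_subproof g h).

Lemma schutz_one_subproof : idfun \in range (@translation a).
Proof.
have st1 : 1 \in stab a by apply/mem_set => x; rewrite mul1r.
apply/mem_set; exists (Sub 1 st1) => //; apply/funext => x.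
by apply: val_inj; rewrite /= mul1r.
Qed.

Definition schutz_one : schutz := Sub idfun schutz_one_subproof.

Lemma schutz_mulA : associative schutz_mul.
Proof. by move=> f g h; apply: val_inj. Qed.

Lemma schutz_mulC : commutative schutz_mul.
Proof.
move=> g h; apply: val_inj; rewrite /=.
have [c ->] := schutzP g; have [d ->] := schutzP h; apply/funext => x.
by apply: val_inj; rewrite /= mulrCA.
Qed.

Lemma schutz_mul1 : left_id schutz_one schutz_mul.
Proof. by move=> g; apply: val_inj. Qed.

Lemma schutz_mulr1 : right_id schutz_one schutz_mul.
Proof. by move=> g; apply: val_inj. Qed.

Lemma schutz_has_inv (g : schutz) : exists h, schutz_mul h g = schutz_one.
Proof.
have [c gc] := schutzP g.
have /(set_mem (valP c))/greenHP[_ [d _ cad]] : Hclass a a by [].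
have st_d : d \in stab a.
  apply/mem_set => x /greenHP[[r _ xE] [s _ aE]]; apply/greenHP; split.
    by exists (d * r) => //; rewrite mulrCA xE.
  by exists (val c * s) => //; rewrite mulrACA aE (mulrC d) mulrAC.
exists (schutz_of (Sub d st_d)); apply: val_inj; rewrite /= gc; apply/funext => x.
apply: val_inj; have /greenHP[[r _ xE] _] := set_mem (valP x).
by rewrite /= -xE (mulrA (val c)) (mulrC d) mulrAC cad.
Qed.

Definition schutz_inv (g : schutz) : schutz := sval (cid (schutz_has_inv g)).

Lemma schutz_mulV : left_inverse schutz_one schutz_inv schutz_mul.
Proof. by move=> g; rewrite /schutz_inv; case: cid. Qed.

Lemma schutz_mulrV : right_inverse schutz_one schutz_inv schutz_mul.
Proof. by move=> g; rewrite schutz_mulC schutz_mulV. Qed.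

HB.instance Definition _ := isGroup.Build schutz
  schutz_mulA schutz_mul1 schutz_mulr1 schutz_mulV schutz_mulrV.
HB.instance Definition _ := Group_isCommutative.Build schutz schutz_mulC.

End Schutzenberger.

Definition is_ideal (I : set R) : Prop :=
  [/\ I 0, forall x y, I x -> I y -> I (x + y) & forall r x, I x -> I (r * x)].

Definition epsilon a : rat := if `[< greenH (a ^+ 2) a >] then 1 / 2 else 1.

End Semigroup.

Definition principal_ideal_ring (R : comPzRingType) : Prop :=
  forall I : set R, is_ideal I -> exists x, I = pideal x.

(* Main.v *)
(* An irreducible sequence of product a splits into an irredundant subsequence
   generating (a), whose partial products form a chain of at most Psi(a) proper
   inclusions, and terms that are units modulo Ann(a); by irreducibility the
   latter form a zero-sum free sequence over U(R_a), of length < D(U(R_a)).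

   Conversely, lift a zero-sum free sequence over U(R_a) to R. If (a^2) <> (a),
   adjoining a multiple of a that generates (a) gives an irreducible sequence of
   product a. If (a^2) = (a), then (a) is generated by an idempotent e and
   U(R_a) is the unit group of e R, which contains a; a minimal zero-sum sequence
   splits into two parts of products a and a^-1, one of which contains at least
   half of the terms.

   In a finite principal ideal ring, a is associated to a product of generators
   of maximal ideals, and an irredundant such product has at least Psi(a) factors
   because multiplying by one of them lengthens chains by at most one. Units
   modulo Ann(a) lift to units of R, so these factors, up to a unit, together with
   the lifted zero-sum free sequence, form an irreducible sequence. *)
From HB Require Import structures.
Require Import Defs.
From mathcomp Require Import all_boot all_order all_algebra.
From mathcomp Require Import finmap multiset.
From mathcomp Require Import boolp classical_sets functions cardinality.
From mathcomp Require Import constructive_ereal.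

Set Implicit Arguments.
Unset Strict Implicit.
Unset Printing Implicit Defensive.

Import Order.TTheory GRing.Theory Num.Theory.

Local Open Scope mset_scope.
Local Open Scope classical_set_scope.

(** * Suprema and infima of sets of natural numbers *)

Lemma lee_nat (m n : nat) : (m%:R%:E <= n%:R%:E :> \bar rat)%E = (m <= n)%N.
Proof. by rewrite lee_fin ler_nat. Qed.

Lemma nat_sup_max (P : set nat) (n : nat) :
  P n -> (forall m, P m -> (m <= n)%N) -> nat_sup P = n%:R%:E.
Proof.
(* The element [n] of [P] excludes the default value of [supremum]. *)
move=> Pn Pmax; rewrite /nat_sup /supremum ifF; last first.
  by apply/negP => /eqP/seteqP[+ _] => /(_ n%:R%:E); apply; exists n.
apply: xget_subset1; last exact: is_subset1_supremums.
split=> [_ [m Pm <-]|x]; first by rewrite lee_nat Pmax.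
by apply; exists n.
Qed.

Lemma nat_inf_min (P : set nat) (n : nat) :
  P n -> (forall m, P m -> (n <= m)%N) -> nat_inf P = n%:R%:E.
Proof.
move=> Pn Pmin; rewrite /nat_inf /infimum ifF; last first.
  by apply/negP => /eqP/seteqP[+ _] => /(_ n%:R%:E); apply; exists n.
apply: xget_subset1; last exact: is_subset1_infimums.
split=> [_ [m Pm <-]|x]; first by rewrite lee_nat Pmin.
by apply; exists n.
Qed.

Lemma nat_sup_pinfty (P : set nat) :
  (forall n, exists2 m, P m & (n <= m)%N) -> nat_sup P = +oo%E.
Proof.
move=> Punb; have [m0 Pm0 _] := Punb 0%N.
rewrite /nat_sup /supremum ifF; last first.
  by apply/negP => /eqP/seteqP[+ _] => /(_ m0%:R%:E); apply; exists m0.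
apply: xget_subset1; last exact: is_subset1_supremums.
split=> [x _|x xub]; first by rewrite leey.
case: x xub => [r rub||noub] //; last first.
  by have /noub : [set n%:R%:E | n in P] (m0%:R%:E : \bar rat) by exists m0.
have [m Pm le_m] := Punb (Num.Def.archi_bound `|r|%R).
have /rub : [set n%:R%:E | n in P] (m%:R%:E : \bar rat) by exists m.
rewrite lee_fin leNgt => /negP[]; apply: le_lt_trans (ler_norm r) _.
by apply: lt_le_trans (archi_boundP (normr_ge0 r)) _; rewrite ler_nat.
Qed.

Lemma nat_max_or_unbounded (P : set nat) m0 : P m0 ->
  (exists2 n, P n & forall m, P m -> (m <= n)%N) \/
  (forall n, exists2 m, P m & (n <= m)%N).
Proof.
move=> Pm0; have [[n nub]|nub] := pselect (exists n, forall m, P m -> (m <= n)%N).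
  left; have exP : exists m, `[< P m >] by exists m0; apply/asboolP.
  have ubP m : `[< P m >] -> (m <= n)%N by move/asboolP; apply: nub.
  by case: (ex_maxnP exP ubP) => k /asboolP Pk kmax; exists k => // m /asboolP/kmax.
right=> n; apply: contrapT => noex; apply: nub; exists n => m Pm.
by rewrite leqNgt; apply/negP => /ltnW le_nm; apply: noex; exists m.
Qed.

(** * Splittings of sequences up to permutation, and multisets *)

Lemma perm_cons_cat (T : eqType) (x : T) s s1 s2 :
  perm_eq (x :: s) (s1 ++ s2) ->
  (exists2 t, perm_eq s1 (x :: t) & perm_eq s (t ++ s2)) \/
  (exists2 t, perm_eq s2 (x :: t) & perm_eq s (s1 ++ t)).
Proof.
move=> eq_s; have : x \in s1 ++ s2 by rewrite -(perm_mem eq_s) mem_head.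
rewrite mem_cat => /orP[] /perm_to_rem eq_x; [left|right].
  exists (rem x s1) => //; rewrite -(perm_cons x).
  by apply: perm_trans eq_s _; rewrite -cat_cons perm_cat2r.
exists (rem x s2) => //; rewrite -(perm_cons x); apply: perm_trans eq_s _.
by rewrite perm_sym (perm_catCA [:: x]) perm_cat2l perm_sym.
Qed.

Lemma perm_cat_cat (T : eqType) (s t s1 s2 : seq T) :
  perm_eq (s ++ t) (s1 ++ s2) ->
  exists a1 a2 b1 b2, [/\ perm_eq s (a1 ++ a2), perm_eq t (b1 ++ b2),
    perm_eq s1 (a1 ++ b1) & perm_eq s2 (a2 ++ b2)].
Proof.
elim: s s1 s2 => [|x s IHs] s1 s2 /=.
  by move=> eq_t; exists [::], [::], s1, s2; split.
case/perm_cons_cat => -[u eq_u /IHs[a1 [a2 [b1 [b2 [eq_s eq_t eq1 eq2]]]]]].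
  exists (x :: a1), a2, b1, b2; split=> //=; first by rewrite perm_cons.
  by apply: perm_trans eq_u _; rewrite perm_cons.
exists a1, (x :: a2), b1, b2; split=> //=; last first.
  by apply: perm_trans eq_u _; rewrite perm_cons.
by rewrite perm_sym (perm_catCA a1 [:: x]) /= perm_cons perm_sym.
Qed.

Lemma perm_map_cat (T T' : eqType) (f : T -> T') s s1 s2 :
  perm_eq (map f s) (s1 ++ s2) ->
  exists t1 t2, [/\ perm_eq s (t1 ++ t2), perm_eq s1 (map f t1) &
    perm_eq s2 (map f t2)].
Proof.
elim: s s1 s2 => [|x s IHs] s1 s2 /=.
  rewrite perm_sym => /perm_nilP/eqP; rewrite -size_eq0 size_cat addn_eq0.
  by rewrite !size_eq0 => /andP[/eqP-> /eqP->]; exists [::], [::].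
case/perm_cons_cat => -[u eq_u /IHs[t1 [t2 [eq_s eq1 eq2]]]].
  exists (x :: t1), t2; split=> //=; first by rewrite perm_cons.
  by apply: perm_trans eq_u _; rewrite perm_cons.
exists t1, (x :: t2); split=> //=; last by apply: perm_trans eq_u _; rewrite perm_cons.
by rewrite perm_sym (perm_catCA t1 [:: x]) /= perm_cons perm_sym.
Qed.

Lemma perm_msub (K : choiceType) (A B : {mset K}) :
  (A `<=` B)%mset -> perm_eq B (A ++ (B `\` A)%mset).
Proof.
move=> /msubsetP AB; apply/allP => x _ /=; rewrite count_cat !count_mem_mset.
by rewrite msetE2 subnKC.
Qed.

Lemma seq_mset_sub (K : choiceType) (A : {mset K}) s1 s2 :
  perm_eq A (s1 ++ s2) -> (seq_mset s1 `<=` A)%mset.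
Proof.
move=> /permP eqA; apply/msubsetP => x; rewrite mset_seqE -count_mem_mset eqA.
by rewrite count_cat leq_addr.
Qed.

Lemma size_seq_mset (K : choiceType) (s : seq K) : size (seq_mset s) = size s.
Proof. exact/perm_size/perm_eq_seq_mset. Qed.

(** * Zero-sum free sequences and the Davenport constant *)

HB.instance Definition _ (G : comGroupType) :=
  SemiGroup.isCommutativeLaw.Build G (@monoid.mul G) (@mulgC_subproof G).

Section ZeroSumFree.
Variable G : comGroupType.
Implicit Types (s t : seq G) (x : G).

Local Open Scope group_scope.

Lemma cmulgC : commutative (@monoid.mul G). Proof. exact: mulgC_subproof. Qed.

(** A subsequence is encoded as one part of a splitting up to permutation, which respects
    multiplicities and keeps the complement at hand. *)
Definition zero_sum_free s := forall s1 s2,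
  perm_eq s (s1 ++ s2) -> \prod_(x <- s1) x = 1 -> s1 = [::].

Lemma zero_sum_free_nil : zero_sum_free [::].
Proof. by move=> s1 s2; rewrite perm_sym => /perm_nilP; case: s1. Qed.

Lemma zero_sum_freeW s s1 s2 :
  perm_eq s (s1 ++ s2) -> zero_sum_free s -> zero_sum_free s1.
Proof.
move=> eq_s zs t1 t2 eq_t; apply: (zs _ (t2 ++ s2)).
by apply: perm_trans eq_s _; rewrite catA perm_cat2r.
Qed.

Lemma zero_sum_free_cons x s : zero_sum_free s ->
    (forall s1 s2, perm_eq s (s1 ++ s2) -> x * \prod_(y <- s1) y <> 1) ->
  zero_sum_free (x :: s).
Proof.
move=> zs xs s1 s2 /perm_cons_cat[] [t eq_t eq_s]; last exact: zs eq_s.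
by rewrite (perm_big _ eq_t) big_cons => /(xs _ _ eq_s).
Qed.

(** Cancelling the product of [s1] leaves the complement with product 1. *)
Lemma zero_sum_free_complement s s1 s2 : zero_sum_free s ->
  perm_eq s (s1 ++ s2) -> \prod_(x <- s1) x = \prod_(x <- s) x -> s2 = [::].
Proof.
move=> zs eq_s; rewrite (perm_big _ eq_s) big_cat /= -{1}[LHS]mulg1.
by move/mulgI/esym; apply: (zs _ s1); rewrite perm_sym perm_catC perm_sym.
Qed.

Lemma prod_map_inv s : \prod_(x <- map monoid.inv s) x = (\prod_(x <- s) x)^-1.
Proof.
elim: s => [|x s IHs]; first by rewrite !big_nil invg1.
by rewrite /= !big_cons IHs invgM cmulgC.
Qed.

Lemma zero_sum_free_inv s : zero_sum_free s -> zero_sum_free (map monoid.inv s).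
Proof.
move=> zs s1 s2 /perm_map_cat[t1 [t2 [eq_s eq1 _]]].
rewrite (perm_big _ eq1) prod_map_inv => /eqP; rewrite invg_eq1 => /eqP.
by move=> /(zs _ _ eq_s) t10; move: eq1; rewrite t10 => /perm_nilP.
Qed.

Fixpoint subproducts s : seq G :=
  if s is x :: s'
  then subproducts s' ++ map (monoid.mul x) (subproducts s') else [:: 1].

Lemma mem_subproducts s s1 s2 :
  perm_eq s (s1 ++ s2) -> \prod_(x <- s1) x \in subproducts s.
Proof.
elim: s s1 s2 => [|x s IHs] s1 s2.
  by rewrite perm_sym => /perm_nilP; case: s1 => // _; rewrite big_nil mem_head.
case/perm_cons_cat => -[t eq_t eq_s]; rewrite /= mem_cat; last first.
  by rewrite (IHs _ _ eq_s).
by rewrite (perm_big _ eq_t) big_cons map_f ?orbT // (IHs _ _ eq_s).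
Qed.

(** Some [x] avoids the inverses of the finitely many subproducts of [s], and adjoining it creates
    no subsequence of product 1. *)
Lemma zero_sum_free_unbounded n : infinite_set [set: G] ->
  exists2 s, zero_sum_free s & size s = n.
Proof.
move=> infG; elim: n => [|n [s zs <-]].
  by exists [::] => //; apply: zero_sum_free_nil.
have [x xs] : exists x, x \notin map monoid.inv (subproducts s).
  apply: contrapT => nox; apply: infG; apply/finite_seqP.
  exists (map monoid.inv (subproducts s)); apply/seteqP; split=> // x _ /=.
  by apply/negP => /negP xs; apply: nox; exists x.
exists (x :: s) => //; apply: zero_sum_free_cons => // s1 s2 /mem_subproducts s1P.
move=> /mulg1_eq xE; move/negP: xs; apply.
by rewrite -[x]invgK xE map_f.
Qed.

(* The prefix products of a zero-sum free sequence are pairwise distinct. *)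
Lemma zero_sum_free_bounded : finite_set [set: G] ->
  exists N, forall s, zero_sum_free s -> (size s <= N)%N.
Proof.
case/finite_seqP => L LE; exists (size L) => s zs.
pose p i := \prod_(x <- take i s) x.
have p_inj i j : (i < j <= size s)%N -> p i <> p j.
  case/andP=> lt_ij le_js; rewrite /p -(cat_take_drop i (take j s)).
  rewrite big_cat /= take_takel ?(ltnW lt_ij) // -{1}[LHS]mulg1 => /mulgI/esym.
  move/(zs _ (take i s ++ drop j s)) => d0.
  suff: size (drop i (take j s)) = 0%N.
    by rewrite size_drop size_takel // => /eqP; rewrite subn_eq0 leqNgt lt_ij.
  rewrite d0 // -{1}(cat_take_drop j s) -{1}(cat_take_drop i (take j s)).
  by rewrite take_takel ?(ltnW lt_ij) // catA perm_cat2r perm_catC.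
have up : uniq (map p (iota 0 (size s))).
  rewrite map_inj_in_uniq ?iota_uniq // => i j; rewrite !mem_iota /= !add0n.
  move=> lt_i lt_j eq_p; case: (ltngtP i j) => // lt_ij.
    by case: (@p_inj i j) => //; rewrite lt_ij ltnW.
  by case: (@p_inj j i) => //; rewrite lt_ij ltnW.
rewrite -(size_iota 0 (size s)) -(size_map p); apply: uniq_leq_size => // x _.
by have : [set: G] x by []; rewrite LE.
Qed.

(** By maximality, a sequence longer than [s] has a nonempty subsequence of product 1, while [s]
    itself rules out every [l] up to its length. *)
Lemma davenport_zero_sum_free s : zero_sum_free s ->
    (forall t, zero_sum_free t -> (size t <= size s)%N) ->
  davenport G = (size s).+1%:R%:E.
Proof.
move=> zs smax; apply: nat_inf_min => [|l [_ lP]].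
  split=> // T le_T; apply: contrapT => noT.
  have /smax : zero_sum_free T; last by rewrite leqNgt le_T.
  move=> s1 s2 eq_T s11; apply: contrapT => s1n0; apply: noT.
  exists (seq_mset s1); split; first exact: seq_mset_sub eq_T.
    apply: contra_notN s1n0 => /eqP s10; apply/nilP.
    by rewrite /nilp -size_seq_mset s10 enum_mset0.
  by rewrite (perm_big _ (perm_eq_seq_mset s1)).
rewrite ltnNge; apply/negP; rewrite -(size_seq_mset s) => /lP[T' [subT' T'n0 T'1]].
have /zs/(_ T'1) : perm_eq s (T' ++ (seq_mset s `\` T')%mset).
  by apply: perm_trans (perm_msub subT'); rewrite perm_sym perm_eq_seq_mset.
move=> T'E; case/negP: T'n0; apply/eqP/msetP => x.
by rewrite -count_mem_mset T'E mset0E.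
Qed.

Lemma davenport_finite : finite_set [set: G] -> exists2 s, zero_sum_free s &
  (forall t, zero_sum_free t -> (size t <= size s)%N) /\
  davenport G = (size s).+1%:R%:E.
Proof.
move=> /zero_sum_free_bounded[N leN].
pose P := [set size s | s in zero_sum_free].
have P0 : P 0%N by exists [::] => //; apply: zero_sum_free_nil.
have [[_ [s zs <-] smax]|/(_ N.+1)[_ [s zs <-]]] := nat_max_or_unbounded P0; last first.
  by rewrite ltnNge leN.
have {}smax t : zero_sum_free t -> (size t <= size s)%N.
  by move=> zt; apply: smax; exists t.
by exists s => //; split=> //; apply: davenport_zero_sum_free.
Qed.

(* If x is a nonempty subproduct of s, then x = prod s1 splits the minimal
   zero-sum sequence (prod s)^-1 :: s into s1 and a complement of product x^-1:
   the longer of s1 and the inverse of the complement will do. Otherwise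
   x / prod s :: s itself works. *)
Lemma zero_sum_free_half s x : zero_sum_free s -> exists t,
  [/\ \prod_(y <- t) y = x, (size s < (size t).*2)%N &
    forall t1 t2, perm_eq t (t1 ++ t2) -> t1 <> [::] ->
      \prod_(y <- t1) y = x -> t2 = [::]].
Proof.
move=> zs.
have [[s1 [s2 [eq_s s1n0 s1x]]]|nosub] := pselect (exists s1 s2,
  [/\ perm_eq s (s1 ++ s2), s1 <> [::] & \prod_(y <- s1) y = x]); last first.
  exists (x * (\prod_(y <- s) y)^-1 :: s).
  split; [by rewrite big_cons mulgVK | by rewrite /= -addnn leq_addl |].
  move=> t1 t2 /perm_cons_cat[] [t eq_t eq_s] t1n0 t1x; last first.
    by case: nosub; exists t1, t; split.
  apply: (zero_sum_free_complement zs eq_s).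
  move: t1x; rewrite (perm_big _ eq_t) big_cons /= -mulgA -{2}[x]mulg1 => /mulgI.
  by move/mulg1_eq; rewrite invgK.
have [le_s1|lt_s1] := ltnP (size s) (size s1).*2.
  exists s1; split=> // t1 t2 eq_t _; rewrite -s1x.
  exact: (zero_sum_free_complement (zero_sum_freeW eq_s zs)).
have eq_s' : perm_eq s (s2 ++ s1) by rewrite perm_sym perm_catC perm_sym.
pose u := map monoid.inv ((\prod_(y <- s) y)^-1 :: s2).
have zu : zero_sum_free u.
  apply/zero_sum_free_inv/zero_sum_free_cons; first exact: zero_sum_freeW eq_s' zs.
  move=> v1 v2 eq_v /mulg1_eq; rewrite invgK => /esym v1E.
  (* Here [v1] would have the full product of [s], although its complement contains the nonempty
     [s1]. *)
  have eq_s'' : perm_eq s (v1 ++ (v2 ++ s1)).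
    by apply: perm_trans eq_s' _; rewrite catA perm_cat2r.
  have /(congr1 size)/eqP := zero_sum_free_complement zs eq_s'' v1E.
  by rewrite size_cat addn_eq0 !size_eq0 => /andP[_ /eqP].
have ux : \prod_(y <- u) y = x.
  rewrite prod_map_inv big_cons (perm_big _ eq_s) big_cat /= s1x.
  by rewrite invgM invgK (cmulgC x) mulKg.
exists u; split=> // [|t1 t2 eq_u _]; last first.
  by rewrite -ux; apply: zero_sum_free_complement.
rewrite size_map /=; move/perm_size: eq_s; rewrite size_cat => eq_s.
move: lt_s1; rewrite eq_s doubleS -!addnn leq_add2l => le12.
by rewrite ltnS leqW // leq_add2r.
Qed.

End ZeroSumFree.

(** * Irreducible sequences and chains of principal ideals *)

Section RingFactorizations.
Variable R : comPzRingType.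
Implicit Types (a c x y : R) (s t : seq R).

Local Open Scope ring_scope.

Definition irreducible_seq s := forall s1 s2, perm_eq s (s1 ++ s2) ->
  \prod_(x <- s1) x = \prod_(x <- s) x -> s2 = [::].

Lemma irreducible_seqP (T : {mset R}) : ~ reducible T <-> irreducible_seq T.
Proof.
split=> [irrT s1 s2 eqT s1T|irrT [T' ltT' eqT']].
  apply: contrapT => s2n0; apply: irrT; exists (seq_mset s1); last first.
    by rewrite (perm_big _ (perm_eq_seq_mset s1)).
  rewrite /mproper (seq_mset_sub eqT); apply/negP => leT.
  have := perm_size (perm_msub leT); rewrite size_cat size_seq_mset (perm_size eqT).
  rewrite size_cat -addnA -[LHS]addn0 => /eqP; rewrite eqn_add2l eq_sym addn_eq0.
  by rewrite size_eq0 => /andP[/eqP].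
have [leT' /negP] := andP ltT'; apply.
have /irrT/(_ eqT') T0 := perm_msub leT'; rewrite -msetB_eq0; apply/eqP/msetP => x.
by rewrite -count_mem_mset T0 mset0E.
Qed.

Lemma davenport_at_seq a : davenport_at a =
  nat_sup [set size s | s in [set s | irreducible_seq s /\ \prod_(x <- s) x = a]].
Proof.
congr nat_sup; apply/seteqP; split=> _ [s [irr_s s_a] <-].
  by exists s => //; split=> //; apply/irreducible_seqP.
have eq_s := perm_eq_seq_mset s.
exists (seq_mset s); last exact: size_seq_mset.
split; last by rewrite (perm_big _ eq_s).
apply/irreducible_seqP => s1 s2 eq_s12; rewrite (perm_big _ eq_s).
by apply: irr_s; rewrite -(permPl eq_s).
Qed.

Lemma pidealP x y : pideal x y <-> exists r, y = x * r.
Proof. by split=> [[r _ <-]|[r ->]]; exists r. Qed.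

Lemma pideal_refl x : pideal x x.
Proof. by apply/pidealP; exists 1; rewrite mulr1. Qed.

Lemma pideal_mulr x y : pideal x (x * y).
Proof. by apply/pidealP; exists y. Qed.

Lemma pideal_trans y x z : pideal x y -> pideal y z -> pideal x z.
Proof. by move=> /pidealP[r ->] /pidealP[t ->]; rewrite -mulrA; apply: pideal_mulr. Qed.

Lemma pideal_properP x y : pideal x `<` pideal y <-> pideal y x /\ ~ pideal x y.
Proof. by split=> -[/pideal_subP ? H]; split=> // /pideal_subP. Qed.

Definition ideal_chain a (l : nat) : Prop := exists2 f : nat -> R, f 0%N = a &
  forall i, (i < l)%N -> pideal (f i) `<` pideal (f i.+1).

Lemma ideal_chain0 a : ideal_chain a 0.
Proof. by exists (fun=> a). Qed.

Lemma ideal_chainS a l : ideal_chain a l.+1 <->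
  exists b, [/\ pideal b a, ~ pideal a b & ideal_chain b l].
Proof.
split=> [[f f0 fP]|[b [ba ab [f f0 fP]]]].
  exists (f 1%N); rewrite -f0; have /pideal_properP[] := fP 0%N isT.
  by split=> //; exists (f \o succn) => // i ?; apply: fP.
exists (fun i => if i is j.+1 then f j else a) => // -[_|i /fP//].
by rewrite f0; apply/pideal_properP.
Qed.

(** Since [pideal b a] says that (a) lies in (b), replacing the start [b] of the chain by [a] keeps
    the first inclusion strict. *)
Lemma ideal_chainW a b l : pideal b a -> ideal_chain b l -> ideal_chain a l.
Proof.
move=> ba; case: l => [|l]; first by move=> _; apply: ideal_chain0.
case/ideal_chainS => c [cb bc chain_c]; apply/ideal_chainS; exists c; split=> //.
  exact: pideal_trans cb ba.
by move=> ac; apply: bc; apply: pideal_trans ac.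
Qed.

Lemma Psi_max a : Psi a \is a fin_num -> exists k,
  [/\ Psi a = k%:R%:E, ideal_chain a k & forall l, ideal_chain a l -> (l <= k)%N].
Proof.
have [[k chain_k kmax] _|unb] :=
  @nat_max_or_unbounded (ideal_chain a) 0%N (ideal_chain0 a).
  by exists k; split=> //; apply: nat_sup_max.
by rewrite [Psi a]nat_sup_pinfty.
Qed.

(** The analogue of irreducibility for ideals: when the product of [s] divides [a], a subproduct
    lying in (a) generates (a). *)
Definition irredundant a s := forall s1 s2, perm_eq s (s1 ++ s2) ->
  pideal a (\prod_(x <- s1) x) -> s2 = [::].

Lemma irredundant_subseq a s : pideal a (\prod_(x <- s) x) -> exists s1 s2,
  [/\ perm_eq s (s1 ++ s2), pideal a (\prod_(x <- s1) x) & irredundant a s1].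
Proof.
have [n] := ubnP (size s); elim: n s => // n IHn s /ltnSE le_n a_s.
have [irr_s|] := pselect (irredundant a s).
  by exists s, [::]; rewrite cats0; split.
move=> /existsNP[s1 /existsNP[s2 /not_implyP[eq_s /not_implyP[a_s1 s2n0]]]].
have lt_s1 : (size s1 < n)%N.
  apply: leq_trans le_n; rewrite (perm_size eq_s) size_cat -addn1 leq_add2l.
  by case: s2 s2n0 {eq_s}.
have [t1 [t2 [eq_t a_t irr_t]]] := IHn _ lt_s1 a_s1.
exists t1, (t2 ++ s2); split=> //; apply: perm_trans eq_s _.
by rewrite catA perm_cat2r.
Qed.

(** Dropping terms from the front, one at a time, enlarges the ideal strictly: were a step an
    equality, the term just dropped could be deleted from [s]. *)
Lemma irredundant_chain a s : irredundant a s ->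
    pideal a (\prod_(x <- s) x) -> pideal (\prod_(x <- s) x) a ->
  ideal_chain a (size s).
Proof.
move=> irr_s a_s s_a; apply: (ideal_chainW s_a).
exists (fun i => \prod_(x <- drop i s) x).
  by rewrite drop0.
move=> i lt_i; rewrite (drop_nth 0 lt_i) big_cons; set x := nth 0 s i.
apply/pideal_properP; split; first by rewrite mulrC; apply: pideal_mulr.
case/pidealP => r eq_r.
suff : [:: x] = [::] by [].
apply: (irr_s (take i s ++ drop i.+1 s)).
  rewrite -{1}(cat_take_drop i s) (drop_nth 0 lt_i) -catA perm_cat2l.
  by rewrite -cat1s perm_catC.
apply: pideal_trans a_s _; apply/pidealP; exists r.
rewrite -{3}(cat_take_drop i s) (drop_nth 0 lt_i) !big_cat big_cons /= -/x.
by rewrite -mulrA -eq_r.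
Qed.

(** * Lifting units of R/Ann(a) to R *)

Section Lift.
Variable a : R.
Notation U := (units_of (ann_quot a)).

(** This representative matters only modulo Ann(a), so identities between representatives are stated
    after multiplication by [a]. *)
Definition unit_repr (g : U) : R := repr (val g).

Lemma pi_unit_repr g : \pi_(ann_quot a)%qT (unit_repr g) = val g.
Proof. exact: reprK. Qed.

Lemma ann_quot_eqP x y :
  \pi_(ann_quot a)%qT x = \pi_(ann_quot a)%qT y <-> x * a = y * a.
Proof.
split=> [/eqP|eq_xy]; first by rewrite ann_quot_piE mulrBl subr_eq0 => /eqP.
by apply/eqP; rewrite ann_quot_piE mulrBl eq_xy subrr.
Qed.

Lemma unit_repr_inj g h : unit_repr g * a = unit_repr h * a -> g = h.
Proof. by move/ann_quot_eqP; rewrite !pi_unit_repr; apply: val_inj. Qed.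

Lemma unit_repr1 : unit_repr 1%g * a = a.
Proof. by rewrite -[RHS]mul1r; apply/ann_quot_eqP; rewrite pi_unit_repr. Qed.

Lemma unit_reprM g h : unit_repr (g * h)%g * a = unit_repr g * unit_repr h * a.
Proof.
by apply/ann_quot_eqP; rewrite pi_unit_repr -ann_quot_piM !pi_unit_repr.
Qed.

Lemma unit_repr_prod (gs : seq U) :
  \prod_(g <- gs) unit_repr g * a = unit_repr (\prod_(g <- gs) g)%g * a.
Proof.
elim: gs => [|g gs IHgs]; first by rewrite !big_nil unit_repr1 mul1r.
by rewrite !big_cons unit_reprM -!mulrA IHgs.
Qed.

Lemma unit_reprV g : unit_repr g^-1%g * unit_repr g * a = a.
Proof. by rewrite -unit_reprM mulVg unit_repr1. Qed.

(** The hypothesis says that [d] inverts [c] modulo Ann(a); [g] is the class of [c]. *)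
Lemma unit_repr_surj c d : c * d * a = a -> exists g, unit_repr g * a = c * a.
Proof.
move=> cda; have unit_c : `[< is_unit (\pi_(ann_quot a)%qT c : ann_quot a) >].
  apply/asboolP; exists (\pi_(ann_quot a)%qT d); rewrite [LHS]ann_quot_piM.
  by apply/ann_quot_eqP; rewrite cda mul1r.
pose g : units_of (ann_quot a) := exist _ (\pi_(ann_quot a)%qT c) unit_c.
by exists g; apply/ann_quot_eqP; apply: pi_unit_repr.
Qed.

End Lift.

End RingFactorizations.

(** * The isomorphism between the Schützenberger group and U(R/Ann(a)) *)

Section SchutzenbergerGroup.
Variables (R : comPzRingType) (a : R).

Local Open Scope ring_scope.

Definition base_point : Hclass a := Sub a (mem_set (erefl : Hclass a a)).

(** The image [c * a] of [a] generates (a), so [a = c * a * d] for some [d], which inverts [c]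
    modulo Ann(a). *)
Lemma schutz_unit (g : schutz a) :
  exists u : units_of (ann_quot a), unit_repr u * a = val (val g base_point).
Proof.
have [c gc] := schutzP g.
have /greenHP[_ /pidealP[d eq_d]] := set_mem (valP (val g base_point)).
rewrite gc /= in eq_d *; apply: (@unit_repr_surj _ _ _ d).
by rewrite mulrAC.
Qed.

Definition schutz_to_unit (g : schutz a) : units_of (ann_quot a) :=
  sval (cid (schutz_unit g)).

Lemma schutz_to_unitE g : unit_repr (schutz_to_unit g) * a = val (val g base_point).
Proof. exact: svalP (cid (schutz_unit g)). Qed.

Lemma schutz_to_unitM : {morph schutz_to_unit : g h / (g * h)%g}.
Proof.
move=> g h; apply: unit_repr_inj; rewrite unit_reprM -mulrA !schutz_to_unitE.
have [c gc] := schutzP g; have := schutz_to_unitE g; rewrite gc /= => eq_c.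
have [d hd] := schutzP h.
have -> : val (val (g * h)%g base_point) = val (val g (val h base_point)) by [].
have -> : val (val h base_point) = val d * a by rewrite hd.
by rewrite gc hd mulrCA eq_c mulrCA.
Qed.

HB.instance Definition _ :=
  isMultiplicative.Build (schutz a) (units_of (ann_quot a)) schutz_to_unit
    schutz_to_unitM.

(** Every element of the class is a multiple of [a], so a translation is determined by its value at
    [a]. *)
Lemma schutz_to_unit_inj : injective schutz_to_unit.
Proof.
move=> g h eq_gh; have := schutz_to_unitE g; rewrite eq_gh schutz_to_unitE.
have [c gc] := schutzP g; have [d hd] := schutzP h; rewrite gc hd /= => eq_dc.
apply: val_inj; rewrite gc hd; apply/funext => x; apply: val_inj.
have /greenHP[/pidealP[r eq_x] _] := set_mem (valP x).
change (val c * val x = val d * val x).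
by rewrite eq_x !mulrA eq_dc.
Qed.

Lemma unit_repr_stab (u : units_of (ann_quot a)) : unit_repr u \in stab a.
Proof.
apply/mem_set => x /greenHP[/pidealP[r ->] /pidealP[s eq_s]].
apply/greenHP; split; apply/pidealP; first by exists (unit_repr u * r); rewrite mulrCA.
exists (s * unit_repr u^-1%g).
by rewrite (mulrC s) mulrACA -eq_s (mulrC (unit_repr u)) unit_reprV.
Qed.

Lemma schutz_to_unit_bij : bijective schutz_to_unit.
Proof.
have surj u : schutz_to_unit (schutz_of (Sub (unit_repr u) (unit_repr_stab u))) = u.
  by apply: unit_repr_inj; rewrite schutz_to_unitE.
exists (fun u => schutz_of (Sub (unit_repr u) (unit_repr_stab u))) => // g.
exact: schutz_to_unit_inj.
Qed.

End SchutzenbergerGroup.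

(** * Lower and upper bounds over an arbitrary ring *)

Section DavenportAt.
Variables (R : comPzRingType) (a : R).
Notation U := (units_of (ann_quot a)).

Local Open Scope ring_scope.

Lemma irreducible_lower_bound_nonregular (gs : seq U) :
    ~ greenH (a ^+ 2) a -> zero_sum_free gs ->
  exists s, [/\ irreducible_seq s, \prod_(x <- s) x = a & size s = (size gs).+1].
Proof.
move=> nreg zgs; set p := (\prod_(g <- gs) g)%g.
(* The extra term corrects the product of the lifts to [a]. *)
exists (unit_repr p^-1%g * a :: map (@unit_repr _ a) gs).
have prod_a : \prod_(x <- unit_repr p^-1%g * a :: map (@unit_repr _ a) gs) x = a.
  by rewrite big_cons big_map mulrAC -mulrA unit_repr_prod mulrA unit_reprV.
split=> //; last by rewrite /= size_map.
move=> s1 s2; rewrite prod_a => /perm_cons_cat[] [t eq_t].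
  case/perm_map_cat=> gs1 [gs2 [eq_gs eq1 eq2]] s1_a.
  have gs20 : gs2 = [::]; last by apply/nilP; rewrite /nilp (perm_size eq2) gs20.
  apply: (zero_sum_free_complement zgs eq_gs); rewrite -/p.
  apply: (@mulgI _ p^-1%g); rewrite mulVg; apply: unit_repr_inj.
  rewrite unit_repr1 unit_reprM -mulrA -unit_repr_prod; apply: etrans s1_a.
  by rewrite (perm_big _ eq_t) big_cons (perm_big _ eq1) big_map /= mulrAC -mulrA.
(* Without the extra term, [a] would be a product of lifts, hence a unit modulo Ann(a), and its
   square would generate (a). *)
case/perm_map_cat=> gs1 [gs2 [eq_gs eq1 eq2]] s1_a; case: nreg.
rewrite expr2; apply/greenHP; split; apply/pidealP; first by exists a.
exists (unit_repr (\prod_(g <- gs1) g)^-1%g).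
have := unit_repr_prod gs1; move: s1_a; rewrite (perm_big _ eq1) big_map => -> eq_a.
by rewrite [RHS]mulrC eq_a mulrA unit_reprV.
Qed.

(* (a) is generated by the idempotent e = a d, and g |-> unit_repr g * e
   identifies U with the group of units of e R. *)
Lemma irreducible_lower_bound_regular (gs : seq U) :
    a <> 1 -> greenH (a ^+ 2) a -> zero_sum_free gs ->
  exists s, [/\ irreducible_seq s, \prod_(x <- s) x = a & (size gs < (size s).*2)%N].
Proof.
move=> a_neq1 /greenHP[_ /pidealP[d eq_d]] zgs.
have aad : a * d * a = a by rewrite mulrAC -expr2.
(* In this case [a] is itself a unit modulo Ann(a), with class [h]. *)
have [h eq_h] := unit_repr_surj aad.
have [gs' [prod_gs' size_gs' irr_gs']] := zero_sum_free_half h zgs.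
pose e := a * d; pose f (g : U) := unit_repr g * e.
have ea : e * a = a by [].
have ee : e * e = e by rewrite {2}/e mulrA ea.
have prod_f t : t <> [::] -> \prod_(g <- t) f g = unit_repr (\prod_(g <- t) g)%g * e.
  elim: t => // g [|g' t] IHt _; first by rewrite !big_seq1.
  by rewrite big_cons IHt // [in RHS]big_cons /f mulrACA ee /e !mulrA unit_reprM.
have prod_a : \prod_(x <- map f gs') x = a.
  rewrite big_map prod_f; last by move=> gs'0; rewrite gs'0 in size_gs'.
  by rewrite prod_gs' mulrA eq_h -expr2.
exists (map f gs'); split=> //; last by rewrite size_map.
move=> s1 s2; rewrite prod_a => /perm_map_cat[t1 [t2 [eq_t eq1 eq2]]].
rewrite (perm_big _ eq1) big_map => t1_a.
suff t20 : t2 = [::] by apply/nilP; rewrite /nilp (perm_size eq2) t20.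
(* The empty product is 1 rather than [e], so [prod_f] needs a nonempty sequence; [a <> 1] provides
   it. *)
have t1n0 : t1 <> [::] by move=> t10; rewrite t10 big_nil in t1_a; apply: a_neq1.
apply: (irr_gs' t1) => //; apply: unit_repr_inj.
have := congr1 ( *%R^~ a) t1_a; rewrite /= prod_f // -mulrA ea => ->.
by rewrite eq_h.
Qed.

Lemma irreducible_lower_bound (gs : seq U) : a <> 1 -> zero_sum_free gs ->
  exists s, [/\ irreducible_seq s, \prod_(x <- s) x = a & (size gs < (size s).*2)%N].
Proof.
move=> a_neq1 zgs; have [reg|nreg] := pselect (greenH (a ^+ 2) a).
  exact: irreducible_lower_bound_regular.
have [s [irr_s s_a size_s]] := irreducible_lower_bound_nonregular nreg zgs.
by exists s; split=> //; rewrite -size_s -addnn leq_addr.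
Qed.

(* An irredundant subsequence generating (a) yields a chain of ideals; the
   other terms are units modulo Ann(a) and form a zero-sum free sequence. *)
Lemma irreducible_upper_bound s k n : irreducible_seq s -> \prod_(x <- s) x = a ->
    (forall l, ideal_chain a l -> (l <= k)%N) ->
    (forall gs : seq U, zero_sum_free gs -> (size gs <= n)%N) ->
  (size s <= k + n)%N.
Proof.
move=> irr_s s_a kmax nmax.
have : pideal a (\prod_(x <- s) x) by rewrite s_a; apply: pideal_refl.
case/irredundant_subseq=> s1 [s2 [eq_s a_s1 irr_s1]].
have prod_s12 : \prod_(x <- s1) x * \prod_(x <- s2) x = a.
  by rewrite -big_cat -(perm_big _ eq_s).
have s1_a : pideal (\prod_(x <- s1) x) a by apply/pidealP; exists (\prod_(x <- s2) x).
have [r eq_r] := (pidealP _ _).1 a_s1.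
(* Placing the membership test under the existential lets [choice] return a total function. *)
have unit_s2 c : exists g : U, c \in s2 -> unit_repr g * a = c * a.
  have [c_s2|] := boolP (c \in s2); last by exists 1%g.
  (* Since [a * r] is the product of [s1], multiplying [r] by the other terms of [s2] gives an
     inverse of [c] modulo Ann(a). *)
  have [|g eq_g] := @unit_repr_surj R a c (r * \prod_(x <- rem c s2) x);
    last by exists g.
  rewrite -[RHS]prod_s12 eq_r (perm_big _ (perm_to_rem c_s2)) big_cons /=.
  by rewrite mulrC !mulrA (mulrAC a c).
have [phi phiE] := choice unit_s2.
have prod_phi t : {subset t <= s2} ->
    \prod_(x <- t) x * a = unit_repr (\prod_(g <- map phi t) g)%g * a.
  elim: t => [|c t IHt] sub_t; first by rewrite !big_nil unit_repr1 mul1r.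
  rewrite /= !big_cons /= unit_reprM -!mulrA -IHt => [|x x_t]; last first.
    by rewrite sub_t // inE x_t orbT.
  by rewrite [RHS]mulrCA phiE ?sub_t ?mem_head //; apply: mulrCA.
rewrite (perm_size eq_s) size_cat leq_add //.
  exact: kmax (irredundant_chain irr_s1 a_s1 s1_a).
rewrite -(size_map phi); apply: nmax => v1 v2 /perm_map_cat[t1 [t2 [eq_t eq1 eq2]]].
rewrite (perm_big _ eq1) => t1_1.
suff t10 : t1 = [::] by apply/nilP; rewrite /nilp (perm_size eq1) t10.
(* The product of [t1] fixes [a], hence also [a * r], so deleting [t1] leaves the product of [s]
   unchanged. *)
apply: (irr_s (s1 ++ t2)).
  apply: perm_trans eq_s _; rewrite -catA perm_cat2l; apply: perm_trans eq_t _.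
  by rewrite perm_catC.
have /prod_phi : {subset t1 <= s2} by move=> x x_t; rewrite (perm_mem eq_t) mem_cat x_t.
rewrite t1_1 unit_repr1 => t1_a.
rewrite (perm_big _ eq_s) !big_cat (perm_big _ eq_t) big_cat /=.
rewrite eq_r [RHS]mulrA (mulrAC a r (\prod_(x <- t1) x)).
by rewrite (mulrC a (\prod_(x <- t1) x)) t1_a.
Qed.

End DavenportAt.

(** * Unit lifting in finite rings, and the sharp lower bound in finite principal ideal rings *)

Section PrincipalIdealRing.
Variable R : comPzRingType.
Implicit Types (a c d p q x y : R) (s t : seq R).

Local Open Scope ring_scope.

Lemma is_unitM x y : is_unit x -> is_unit y -> is_unit (x * y).
Proof.
by move=> [x' xx'] [y' yy']; exists (x' * y'); rewrite mulrACA xx' yy' mulr1.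
Qed.

Lemma is_unit_prod s : {in s, forall x, is_unit x} -> is_unit (\prod_(x <- s) x).
Proof.
elim: s => [|x s IHs] us; first by exists 1; rewrite big_nil mulr1.
rewrite big_cons; apply: is_unitM; first by apply: us; rewrite mem_head.
by apply: IHs => y y_s; apply: us; rewrite inE y_s orbT.
Qed.

(** By the pigeonhole principle, the powers of [c] are eventually periodic. *)
Lemma finite_idempotent_power c : finite_set [set: R] ->
  exists n, c ^+ n.+1 * c ^+ n.+1 = c ^+ n.+1.
Proof.
case/finite_seqP => L LE.
have /(uniqPn 0)[i [j []]] : ~~ uniq [seq c ^+ i | i <- iota 0 (size L).+1].
  apply/negP => /uniq_leq_size le_size; have : ((size L).+1 <= size L)%N.
    rewrite -{1}(size_iota 0 (size L).+1) -(size_map (GRing.exp c)).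
    by apply: le_size => x _; have : [set: R] x by []; rewrite LE.
  by rewrite ltnn.
rewrite size_map size_iota => lt_ij lt_j.
rewrite !(nth_map 0%N) ?size_iota ?(ltn_trans lt_ij) // !nth_iota ?(ltn_trans lt_ij) //.
rewrite !add0n => eq_ij; pose q := (j - i).-1.
have jE : j = (i + q.+1)%N by rewrite /q prednK ?subn_gt0 // subnKC // ltnW.
have shift m k : (i <= m)%N -> c ^+ (m + k * q.+1) = c ^+ m.
  move=> /subnKC <-; elim: k => [|k IHk]; first by rewrite mul0n addn0.
  rewrite mulSn -addnA (addnCA (m - i)%N) addnA -jE exprD -eq_ij -exprD addnA.
  exact: IHk.
(* The exponent is [i.+1 * q.+1], a positive multiple of the period that is at least [i]. *)
exists (q + i * q.+1)%N; rewrite -addSn -mulSn -exprD shift //.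
by rewrite (leq_trans (leqnSn i)) ?leq_pmulr.
Qed.

(* With f a power of c that is idempotent, c f + (1 - f) is a unit, and f acts
   as 1 on a. *)
Lemma unit_lift a c d : finite_set [set: R] -> c * d * a = a ->
  exists2 c', is_unit c' & c' * a = c * a.
Proof.
move=> finR cda; have [n ff] := finite_idempotent_power c finR.
set f := c ^+ n.+1 in ff.
have fa : f * a = a.
  have cdXa k : c ^+ k * d ^+ k * a = a.
    elim: k => [|k IHk]; first by rewrite !mul1r.
    by rewrite !exprS mulrACA -[LHS]mulrA IHk.
  by rewrite -{1}(cdXa n.+1) -/f !mulrA ff cdXa.
pose g := 1 - f.
have fg : f * g = 0 by rewrite mulrBr mulr1 ff subrr.
have gg : g * g = g by rewrite {1}/g mulrBl mul1r fg subr0.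
exists (c * f + g); last by rewrite !mulrDl mulNr mul1r -mulrA fa subrr addr0.
(* On the component of [f] the inverse of [c] is [c ^+ n], because [c * c ^+ n = f]; the cross terms
   vanish by [fg]. *)
exists (c ^+ n * f + g).
rewrite mulrDl (mulrDr (c * f)) (mulrDr g) mulrACA -(exprS c n) -/f !ff.
rewrite -(mulrA c) fg mulr0 addr0.
by rewrite (mulrCA g) (mulrC g) fg mulr0 add0r gg addrC subrK.
Qed.

(* Generators of maximal ideals, or units. *)
Definition maximal p := forall y, pideal p y \/ exists r u, y * r + p * u = 1.

Hypothesis pirR : principal_ideal_ring R.

Lemma pir_gcd x y : exists d,
  [/\ pideal d x, pideal d y & exists r u, d = x * r + y * u].
Proof.
have [|d dE] := pirR (I := [set z | exists r u, z = x * r + y * u]).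
  split=> [|_ _ [r [s ->]] [r' [s' ->]]|k _ [r [s ->]]].
  - by exists 0, 0; rewrite !mulr0 addr0.
  - by exists (r + r'), (s + s'); rewrite !mulrDr addrACA.
  - by exists (k * r), (k * s); rewrite mulrDr !(mulrCA k).
exists d; split; rewrite -?dE.
- by exists 1, 0; rewrite mulr1 mulr0 addr0.
- by exists 0, 1; rewrite mulr1 mulr0 add0r.
- by have := pideal_refl d; rewrite -dE.
Qed.

Lemma pideal_add x y z : pideal x y -> pideal x z -> pideal x (y + z).
Proof.
by move=> /pidealP[r ->] /pidealP[s ->]; rewrite -mulrDr; apply: pideal_mulr.
Qed.

Lemma pideal_mulrW x y z : pideal x y -> pideal x (y * z).
Proof. by move=> xy; apply: pideal_trans xy _; apply: pideal_mulr. Qed.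

(* The quotient (x) / (x q) is simple or zero, so the modular law lets a chain
   above (x q) lose at most one step when it is joined with (x). *)
Lemma ideal_chain_mul_maximal q x l : maximal q ->
  ideal_chain (x * q) l.+1 -> ideal_chain x l.
Proof.
move=> max_q; elim: l x => [|l IHl] x; first by move=> _; apply: ideal_chain0.
case/ideal_chainS => g [g_xq xq_g chain_g].
have [g_x|g_x] := pselect (pideal g x); first exact: ideal_chainW chain_g.
have [d [d_x d_g [r [s dE]]]] := pir_gcd x g.
apply/ideal_chainS; exists d; split=> //; last first.
  apply/IHl/(ideal_chainW _ chain_g); rewrite dE mulrDl mulrAC.
  by apply: pideal_add; [apply: pideal_mulrW | rewrite -mulrA; apply: pideal_mulr].
(* If (d) = (x), then [g = x * u]: either [q] divides [u] and (g) lies in (x q), or [u] is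
   invertible modulo [q] and [x] lies in (g). *)
move=> x_d; have /pidealP[u gE] := pideal_trans x_d d_g.
have [/pidealP[w uE]|[r' [s' eq1]]] := max_q u.
  by apply: xq_g; rewrite gE uE mulrA; apply: pideal_mulr.
apply: g_x; rewrite -[x]mulr1 -eq1 mulrDr !mulrA -gE.
by apply: pideal_add; [apply: pideal_mulr | apply: pideal_mulrW].
Qed.

(** Each maximal factor accounts for at most one step, and no chain of positive length starts at
    (1). *)
Lemma ideal_chain_prod_maximal s l : {in s, forall p, maximal p} ->
  ideal_chain (\prod_(p <- s) p) l -> (l <= size s)%N.
Proof.
elim: s l => [|p s IHs] [|l] // max_s.
  rewrite big_nil => /ideal_chainS[b [_ b1 _]]; case: b1.
  by apply/pidealP; exists b; rewrite mul1r.
rewrite big_cons mulrC => /ideal_chain_mul_maximal chain_s; apply: IHs.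
  by move=> q q_s; apply: max_s; rewrite inE q_s orbT.
by apply: chain_s; apply: max_s; rewrite mem_head.
Qed.

(** Induction along a longest chain: if (f) is its first ideal above (x), a generator [p] of the
    colon ideal (x : f) is the new factor, maximal because no ideal fits strictly between (x) and
    (f). *)
Lemma factor_maximal k x : ideal_chain x k ->
    (forall l, ideal_chain x l -> (l <= k)%N) ->
  exists s, {in s, forall p, maximal p} /\ greenH (\prod_(p <- s) p) x.
Proof.
elim: k x => [|k IHk] x chain_x kmax.
  exists [::]; split=> //; rewrite big_nil; apply/greenHP; split; last first.
    by apply/pidealP; exists x; rewrite mul1r.
  apply: contrapT => x1; suff /kmax : ideal_chain x 1 by [].
  apply/ideal_chainS; exists 1; split=> //; last exact: ideal_chain0.
  by apply/pidealP; exists x; rewrite mul1r.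
have /ideal_chainS[f [f_x x_f chain_f]] := chain_x.
have [|s [max_s /greenHP[f_s s_f]]] := IHk f chain_f.
  by move=> l chain_l; rewrite -ltnS; apply/kmax/ideal_chainS; exists f; split.
have [|p pE] := pirR (I := [set y | pideal x (f * y)]).
  split=> [|y z|r y]; rewrite /= ?mulr0 ?mulrDr.
  - by apply/pidealP; exists 0; rewrite mulr0.
  - exact: pideal_add.
  - by rewrite (mulrC r) mulrA; apply: pideal_mulrW.
have pP y : pideal p y <-> pideal x (f * y) by rewrite -pE.
exists (p :: s); split=> [q|]; last first.
  rewrite big_cons; apply/greenHP; split; last first.
    have /pidealP[y xE] := f_x.
    have /pP/pidealP[z yE] : pideal x (f * y) by rewrite -xE; apply: pideal_refl.
    have /pidealP[u fE] := s_f.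
    apply/pidealP; exists (u * z); rewrite {1}xE yE fE.
    by rewrite -!mulrA (mulrCA p) (mulrCA p).
  have /pidealP[u ->] := f_s; rewrite mulrCA mulrA; apply: pideal_mulrW.
  exact/pP/pideal_refl.
rewrite inE => /orP[/eqP-> {q}|]; last exact: max_s.
move=> y; have [|p_y] := pselect (pideal p y); [by left | right].
have {}p_y : ~ pideal x (f * y) by move/pP.
have [d [d_x d_fy [r [t dE]]]] := pir_gcd x (f * y).
(* Otherwise (d) would lie strictly between (x) and (f), giving a chain longer than allowed. *)
have /pidealP[w fE] : pideal d f.
  apply: contrapT => d_f; suff /kmax : ideal_chain x k.+2 by rewrite ltnn.
  apply/ideal_chainS; exists d; split=> //.
    by move=> x_d; apply: p_y; apply: pideal_trans d_fy.
  apply/ideal_chainS; exists f; split=> //; rewrite dE.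
  by apply: pideal_add; [apply: pideal_mulrW | rewrite -mulrA; apply: pideal_mulr].
have /pP/pidealP[z zE] : pideal x (f * (1 - y * t * w)).
  rewrite mulrBr mulr1 {1}fE dE mulrDl !mulrA addrK -mulrA; exact: pideal_mulr.
by exists (t * w), z; rewrite -zE mulrA addrC subrK.
Qed.

Lemma pir_irreducible_lower_bound a k (gs : seq (units_of (ann_quot a))) :
    finite_set [set: R] -> ~ is_unit a -> ideal_chain a k ->
    (forall l, ideal_chain a l -> (l <= k)%N) -> zero_sum_free gs ->
  exists s, [/\ irreducible_seq s, \prod_(x <- s) x = a & (k + size gs <= size s)%N].
Proof.
move=> finR nunit_a chain_a kmax zgs.
have [ps [max_ps /greenHP[a_ps ps_a]]] := factor_maximal chain_a kmax.
have [s1 [s2 [eq_ps a_s1 irr_s1]]] := irredundant_subseq a_ps.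
have le_k : (k <= size s1)%N.
  apply: ideal_chain_prod_maximal (ideal_chainW a_s1 chain_a) => p p_s1.
  by apply: max_ps; rewrite (perm_mem eq_ps) mem_cat p_s1.
have /pidealP[y aE] : pideal (\prod_(p <- s1) p) a.
  apply: pideal_trans ps_a; rewrite (perm_big _ eq_ps) big_cat.
  exact: pideal_mulr.
have [r s1E] := (pidealP _ _).1 a_s1.
(* The cofactor [r] is invertible modulo Ann(a), so a true unit [v] of [R] can replace it in front
   of [a]. *)
have [v unit_v va] : exists2 v, is_unit v & v * a = r * a.
  by apply: (@unit_lift _ _ y); rewrite // mulrC mulrA -s1E -aE.
have unit_lift_g (g : units_of (ann_quot a)) :
    exists c, is_unit c /\ c * a = unit_repr g * a.
  have [|c unit_c cE] := @unit_lift a (unit_repr g) (unit_repr g^-1%g) finR.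
    by rewrite (mulrC (unit_repr g)); apply: unit_reprV.
  by exists c.
have [w wE] := choice unit_lift_g.
have unit_w (hs : seq (units_of (ann_quot a))) : is_unit (\prod_(x <- map w hs) x).
  by apply: is_unit_prod => _ /mapP[g _ ->]; have [] := wE g.
have w_repr (hs : seq (units_of (ann_quot a))) :
    \prod_(x <- map w hs) x * a = unit_repr (\prod_(g <- hs) g)%g * a.
  elim: hs => [|g hs IHhs]; first by rewrite !big_nil unit_repr1 mul1r.
  rewrite /= !big_cons /= unit_reprM -!mulrA -IHhs [RHS]mulrCA -(wE g).2.
  exact: mulrCA.
(* As [a] is not a unit, [s1] has a first term [p]; multiplied by [z], it will compensate for [v]
   and the lifted units. *)
case: s1 => [|p s'] in eq_ps a_s1 irr_s1 le_k aE s1E *.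
  by case: nunit_a; exists r; rewrite -s1E big_nil.
have [z vwz] := is_unitM unit_v (unit_w gs).
have unit_z : is_unit z by exists (v * \prod_(x <- map w gs) x); rewrite mulrC.
have zp_s' : z * p * \prod_(x <- s') x = z * v * a.
  by rewrite -!mulrA va (mulrC r) -s1E big_cons.
exists ((z * p :: s') ++ map w gs).
have prod_a : \prod_(x <- (z * p :: s') ++ map w gs) x = a.
  by rewrite big_cat big_cons /= zp_s' mulrAC -(mulrA z) (mulrC z) vwz mul1r.
split=> //; last by rewrite size_cat size_map leq_add2r.
move=> t1 t2; rewrite prod_a => /perm_cat_cat[a1 [a2 [b1 [b2 [eq_s eq_gs eq1 eq2]]]]].
rewrite (perm_big _ eq1) big_cat /= => t1_a.
have [hs1 [hs2 [eq_hs eqb1 eqb2]]] := perm_map_cat eq_gs.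
have [i b1i] : is_unit (\prod_(x <- b1) x) by rewrite (perm_big _ eqb1); apply: unit_w.
rewrite (perm_big _ eqb1) /= in b1i t1_a.
have [[t eq_t eq_s']|[t eq_t eq_s']] := perm_cons_cat eq_s; last first.
  (* If [z * p] is omitted, the factors [a1] already have their product in (a), against
     irredundancy. *)
  suff : p :: t = [::] by [].
  apply: (irr_s1 a1).
    by rewrite perm_sym (perm_catCA a1 [:: p]) /= perm_cons perm_sym.
  apply/pidealP; exists i; have := congr1 ( *%R^~ i) t1_a.
  by rewrite /= -mulrA b1i mulr1.
(* Units do not change ideals: [p :: t] already has its product in (a), so no factor is left out. *)
have a20 : a2 = [::].
  apply: (irr_s1 (p :: t)); first by rewrite /= perm_cons.
  apply/pidealP; have [j zj] := unit_z; exists (j * i).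
  have := congr1 ( *%R^~ (j * i)) t1_a; rewrite /= (perm_big _ eq_t) !big_cons /= => <-.
  rewrite [j * i]mulrC [RHS]mulrA -(mulrA (z * p * _)) b1i mulr1.
  by rewrite [RHS]mulrC -!mulrA (mulrA j) (mulrC j) zj mul1r.
(* Every factor being used, only the unit parts remain to be compared modulo Ann(a), where zero-sum
   freeness applies. *)
suff hs20 : hs2 = [::].
  by apply/nilP; rewrite /nilp (perm_size eq2) size_cat a20 (perm_size eqb2) hs20.
apply: (zero_sum_free_complement zgs eq_hs); apply: unit_repr_inj.
rewrite -!w_repr; rewrite a20 cats0 in eq_s.
move: t1_a; rewrite -(perm_big _ eq_s) big_cons /= zp_s' => t1_a.
have wzv : \prod_(x <- map w gs) x * z * v = 1 by rewrite mulrC mulrA vwz.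
apply: etrans (congr1 ( *%R (\prod_(x <- map w gs) x)) t1_a).
by rewrite !mulrA wzv mul1r mulrC.
Qed.

End PrincipalIdealRing.

(** * Finiteness of the unit group and assembly of the bounds *)

Lemma finite_units_ann_quot (R : comPzRingType) (a : R) :
  finite_set [set: R] -> finite_set [set: units_of (ann_quot a)].
Proof.
move=> finR; apply: (@sub_finite_set _ _ (@unit_repr R a @^-1` [set: R])) => //.
apply: finite_preimage finR => g h _ _ eq_gh.
by apply: unit_repr_inj; rewrite eq_gh.
Qed.

Local Open Scope ereal_scope.

Theorem theorem1p3 (R : comPzRingType) (a : R)
    (a_neq1 : a <> 1%R) (Psi_fin : Psi a \is a fin_num) :
  let U := units_of (ann_quot a) in
  [/\ exists phi : {multiplicative schutz a -> U}, bijective phi,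
      infinite_set [set: U] -> davenport_at a = +oo,
      finite_set [set: U] ->
        [/\ davenport_at a \is a fin_num,
            (epsilon a)%:E * davenport U <= davenport_at a
          & davenport_at a <= Psi a + davenport U - 1]
    & finite_set [set: R] -> principal_ideal_ring R -> ~ is_unit a ->
        davenport_at a = Psi a + davenport U - 1].
Proof.
move=> U; have [k [PsiE chain_a kmax]] := Psi_max Psi_fin.
pose P := [set size s | s in
  [set s : seq R | irreducible_seq s /\ \prod_(x <- s) x = a]]%R.
have DaE : davenport_at a = nat_sup P by apply: davenport_at_seq.
(* The lower bound makes [P] nonempty and the upper bound makes it bounded, so its supremum is a
   maximum. *)
have max_davenport gs : @zero_sum_free U gs ->
    (forall hs, @zero_sum_free U hs -> (size hs <= size gs)%N) ->
  exists2 m, P m & [/\ (forall l, P l -> (l <= m)%N), davenport_at a = m%:R%:E &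
    (m <= k + size gs)%N].
  move=> zgs gsmax.
  have [s0 [irr_s0 s0_a _]] := irreducible_lower_bound a_neq1 zgs.
  have Ps0 : P (size s0) by exists s0.
  have bound l : P l -> (l <= k + size gs)%N.
    by case=> s [irr_s s_a] <-; apply: irreducible_upper_bound irr_s s_a kmax gsmax.
  have [[m Pm mmax]|/(_ (k + size gs).+1)[m /bound]] := nat_max_or_unbounded Ps0.
    exists m => //; split=> //; last exact: bound.
    by rewrite DaE; apply: nat_sup_max.
  by rewrite leqNgt => /negP.
have PsiD (gs : seq U) : davenport U = (size gs).+1%:R%:E ->
    Psi a + davenport U - 1 = (k + size gs)%:R%:E.
  move=> ->; rewrite PsiE -[LHS]/((k%:R + (size gs).+1%:R - 1)%R%:E).
  by rewrite -natrD addnS -natr1 addrK.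
split.
- by exists (schutz_to_unit (a := a)); apply: schutz_to_unit_bij.
- move=> infU; rewrite DaE; apply: nat_sup_pinfty => n.
  (* Length [n.*2] makes up for the factor 2 lost in the general lower bound. *)
  have [gs zgs gs_n] := zero_sum_free_unbounded n.*2 infU.
  have [s [irr_s s_a]] := irreducible_lower_bound a_neq1 zgs.
  by rewrite gs_n ltn_double => /ltnW le_n; exists (size s) => //; exists s.
- move=> finU; have [gs zgs [gsmax DU]] := davenport_finite finU.
  have [m _ [mmax DaM le_m]] := max_davenport _ zgs gsmax.
  split; rewrite DaM //; last by rewrite (PsiD gs DU) lee_nat.
  rewrite DU -EFinM lee_fin /epsilon; case: asboolP => reg.
    have [s [irr_s s_a lt_s]] := irreducible_lower_bound a_neq1 zgs.
    have /mmax le_sm : P (size s) by exists s.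
    rewrite mul1r mulrC ler_pdivrMr // -natrM ler_nat muln2.
    by apply: leq_trans lt_s _; rewrite leq_double.
  have [s [irr_s s_a <-]] := irreducible_lower_bound_nonregular reg zgs.
  by rewrite mul1r ler_nat; apply: mmax; exists s.
- move=> finR pirR nunit_a.
  have finU : finite_set [set: U] by apply: finite_units_ann_quot.
  have [gs zgs [gsmax DU]] := davenport_finite finU.
  have [m _ [mmax DaM le_m]] := max_davenport _ zgs gsmax.
  have [s [irr_s s_a le_s]] :=
    pir_irreducible_lower_bound pirR finR nunit_a chain_a kmax zgs.
  rewrite DaM (PsiD gs DU); congr (_%:R%:E)%R; apply/eqP; rewrite eqn_leq le_m.
  by apply: leq_trans le_s (mmax _ _); exists s.
Qed.
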